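(* Let $G$ be a finite group of order $n$, and suppose the topological connection of oscillators is given by a $G$-circulant matrix $A=(a_{\tau\sigma})_{\tau,\sigma\in G}$, $a_{\tau\sigma}=c_{\tau^{-1}\sigma}$, with $c_g\in\mathbb{R}$ for $g\in G$. Let $\epsilon\in\mathbb{R}$. Let $\chi:G\to\mathbb{C}^\times$ be a $1$-dimensional representation of $G$, let $v_\chi=(\chi(\sigma))_{\sigma\in G}^T$, let $Y_\chi=\sum_{\sigma\in G}c_\sigma\chi(\sigma)$, let $\arg(v_\chi)=(\arg(\chi(\sigma)))_{\sigma\in G}$, and let $\phi=\arg(Y_\chi)$. Then, indexing the oscillators by the elements of $G$ (so that $i,j$ range over $G$ below): (1) $\arg(v_\chi)$ is an equilibrium point of the original phase-lag Kuramoto model $$\frac{d\theta_i}{dt}=\epsilon\sum_{j}a_{ij}\sin(\theta_j-\theta_i-\phi);$$ (2) $\arg(v_\chi)$ is an equilibrium point of the associated phase-lag complex-valued model $$\frac{d\theta_i}{dt}=\epsilon\sum_{j}a_{ij}\left(\sin(\theta_j-\theta_i-\phi)-\mathbf{i}\cos(\theta_j-\theta_i-\phi)\right).$$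
   Context: Here $\mathbf{i}=\sqrt{-1}$, and exponentials and arguments of vectors are taken entrywise. A matrix is $G$-circulant if it has the form $(c_{\tau^{-1}\sigma})_{\tau,\sigma\in G}$ (row index $\tau$, column index $\sigma$). Each $\chi(\sigma)$ is an $n$-th root of unity, so $\arg(v_\chi)$ is a real vector with entries in $\frac{2\pi}{n}\mathbb{Z}$. The number $\phi=\arg(Y_\chi)$ is a real number with $Y_\chi=|Y_\chi|e^{\mathbf{i}\phi}$ (if $Y_\chi=0$, any real $\phi$ qualifies). A real point $\theta_0$ is an equilibrium point of the original phase-lag model if all right-hand sides vanish at $\theta_0$. In the phase-lag complex-valued model $\theta_i\in\mathbb{C}$; under $x=e^{\mathbf{i}\theta}$ it becomes $\frac{dx}{dt}=\epsilon e^{-\mathbf{i}\phi}Ax$, with solution $x(t)=e^{\epsilon e^{-\mathbf{i}\phi}At}x(0)$. A real vector $\theta_0$ is an equilibrium point of it if, with $x_0=e^{\mathbf{i}\theta_0}$, for all $t\ge0$ one has $\arg(e^{\epsilon e^{-\mathbf{i}\phi}At}x_0)=\arg(x_0)=\theta_0$, arguments being understood modulo $2\pi$ (in particular every entry of $e^{\epsilon e^{-\mathbf{i}\phi}At}x_0$ is nonzero). *)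

(* Defs.v *)
From HB Require Import structures.
From mathcomp Require Import all_boot all_order all_algebra all_fingroup.
From mathcomp Require Import mxrepresentation complex.
From mathcomp Require Import all_classical all_reals all_analysis.
From mathcomp Require Import ring.

Set Implicit Arguments.
Unset Strict Implicit.
Unset Printing Implicit Defensive.

Import Order.TTheory GRing.Theory Num.Theory.
Import numFieldNormedType.Exports.

Local Open Scope ring_scope.
Local Open Scope complex_scope.

Definition cexp (R : realType) (z : R[i]) : R[i] :=
  (expR (complex.Re z))%:C * (cos (complex.Im z) +i* sin (complex.Im z)).

Definition csin (R : realType) (z : R[i]) : R[i] :=
  (cexp ('i * z) - cexp (- ('i * z))) / (2%:R * 'i).

Definition ccos (R : realType) (z : R[i]) : R[i] :=
  (cexp ('i * z) + cexp (- ('i * z))) / 2%:R.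

(* [t] is one of the arguments of [z]: no branch is chosen, so statements about
   arguments hold modulo 2 pi, and every [t] is an argument of 0. *)
Definition is_arg (R : realType) (z : R[i]) (t : R) : Prop :=
  z = `|z| * cexp ('i * t%:C).

(* The matrices are typed over [R[i]^o] because that is the copy of [R[i]]
   which carries the topology of the complex modulus. *)
Definition expm (R : realType) (n : nat) (M : 'M[R[i]]_n) : 'M[R[i]]_n :=
  lim (series (fun k => (k`!%:R)^-1 *: M ^+ k : 'M[R[i]^o]_n) @ \oo)%classic.

(* Rows and columns are indexed by the elements of the group through
   [enum_val : 'I_#|gT| -> gT]. *)
Definition circulant (T : Type) (gT : finGroupType) (c : gT -> T) :
    'M[T]_#|gT| :=
  \matrix_(i, j) c ((enum_val i)^-1 * enum_val j)%g.

Definition group_vec (T : Type) (gT : finGroupType) (f : gT -> T) :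
    'cV[T]_#|gT| :=
  \col_i f (enum_val i).

Definition repr1 (R : realType) (gT : finGroupType) (chi : gT -> R[i]) : Prop :=
  mx_repr [set: gT] (fun g => (chi g)%:M : 'M[R[i]]_1).

Definition phase_lag_rhs (R : realType) (n : nat) (A : 'M[R]_n) (eps phi : R)
    (theta : 'cV[R]_n) : 'cV[R]_n :=
  \col_i (eps * \sum_j A i j * sin (theta j 0 - theta i 0 - phi)).

Definition phase_lag_equilibrium (R : realType) (n : nat) (A : 'M[R]_n)
    (eps phi : R) (theta0 : 'cV[R]_n) : Prop :=
  forall i, phase_lag_rhs A eps phi theta0 i 0 = 0.

Definition complex_phase_lag_rhs (R : realType) (n : nat) (A : 'M[R]_n)
    (eps phi : R) (theta : 'cV[R[i]]_n) : 'cV[R[i]]_n :=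
  \col_i (eps%:C * \sum_j (A i j)%:C *
    (csin (theta j 0 - theta i 0 - phi%:C) -
     'i * ccos (theta j 0 - theta i 0 - phi%:C))).

Definition phase_lag_mx (R : realType) (n : nat) (A : 'M[R]_n) (eps phi : R) :
    'M[R[i]]_n :=
  (eps%:C * cexp (- ('i * phi%:C))) *: map_mx (real_complex R) A.

Lemma cexpD (R : realType) (z w : R[i]) : cexp (z + w) = cexp z * cexp w.
Proof.
case: z w => [a b] [c d]; rewrite /cexp /= expRD cosD sinD.
by apply/eqP; rewrite eq_complex /=; apply/andP; split; apply/eqP; ring.
Qed.

(* The substitution [x = cexp ('i * theta)] gives
   [dx_i/dt = 'i * x_i * dtheta_i/dt], so this identity says that it turns
   [dtheta/dt = complex_phase_lag_rhs A eps phi theta] into the linear system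
   [dx/dt = phase_lag_mx A eps phi *m x]. *)
Lemma complex_phase_lag_linearE (R : realType) (n : nat) (A : 'M[R]_n)
    (eps phi : R) (theta : 'cV[R[i]]_n) (i : 'I_n) :
  let x := \col_j cexp ('i * theta j 0) in
  'i * x i 0 * complex_phase_lag_rhs A eps phi theta i 0 =
  (phase_lag_mx A eps phi *m x) i 0.
Proof.
have i2 : 'i * 'i = -1 :> R[i] by rewrite -expr2 sqr_i.
have i0 : 'i != 0 :> R[i].
  by apply/eqP => /(congr1 (@complex.Im R)) /= /eqP; rewrite oner_eq0.
have lagE z : csin z - 'i * ccos z = - 'i * cexp ('i * z) :> R[i].
  have alg (p q I : R[i]) : I * I = -1 -> I != 0 ->
      (p - q) / (2%:R * I) - I * ((p + q) / 2%:R) = - I * p.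
    move=> I2 In0; have Iv : I^-1 = - I.
      by apply: (mulfI In0); rewrite mulfV // mulrN I2 opprK.
    by rewrite invfM Iv; field.
  exact: alg.
move=> x; rewrite /x !mxE.
set xi := cexp ('i * theta i 0); rewrite !mulr_sumr; apply: eq_bigr => j _.
rewrite !mxE lagE.
have -> : cexp ('i * theta j 0) =
    xi * cexp ('i * (theta j 0 - theta i 0 - phi%:C)) * cexp ('i * phi%:C).
  by rewrite /xi -!cexpD; congr cexp; ring.
have eN : cexp (- ('i * phi%:C)) * cexp ('i * phi%:C) = 1.
  by rewrite -cexpD addNr /cexp /= expR0 cos0 sin0 mul1r.
have alg (I x0 e a w p q : R[i]) : I * I = -1 -> q * p = 1 ->
    I * x0 * (e * (a * (- I * w))) = e * q * a * (x0 * w * p).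
  move=> I2 qp; transitivity (- (I * I) * (x0 * e * a * w)); first by ring.
  rewrite I2; transitivity (q * p * (x0 * e * a * w)); last by ring.
  by rewrite qp; ring.
exact: alg.
Qed.

(* The solution of the linear system starting at [x0] is
   [expm (t * phase_lag_mx A eps phi) *m x0]; an equilibrium is a point whose
   phases (but not necessarily amplitudes) are constant along it. *)
Definition complex_phase_lag_equilibrium (R : realType) (n : nat) (A : 'M[R]_n)
    (eps phi : R) (theta0 : 'cV[R]_n) : Prop :=
  let x0 : 'cV[R[i]]_n := \col_j cexp ('i * (theta0 j 0)%:C) in
  forall t : R, 0 <= t -> forall i,
    let xt := (expm (t%:C *: phase_lag_mx A eps phi) *m x0) i 0 in
    xt != 0 /\ is_arg xt (theta0 i 0).

(* Main.v *)
(* A one-dimensional character chi takes values of modulus 1 and v_chi is an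
   eigenvector of the circulant matrix A with eigenvalue Y_chi.  The factor
   exp(-i phi) turns that eigenvalue into |Y_chi|, so the vector
   x0 = exp(i theta) = v_chi is an eigenvector of eps exp(-i phi) A for the real
   eigenvalue r = eps |Y_chi|.  Hence exp(t eps exp(-i phi) A) x0 = e^(t r) x0
   keeps its phases, and the right-hand side of the real model, which is the
   imaginary part of conj(x0_i) (eps exp(-i phi) A x0)_i = r, vanishes. *)
Require Import Defs.
From HB Require Import structures.
From mathcomp Require Import all_boot all_order all_algebra all_fingroup.
From mathcomp Require Import mxrepresentation complex.
From mathcomp Require Import all_classical all_reals all_analysis.
From mathcomp Require Import ring.

Set Implicit Arguments.
Unset Strict Implicit.
Unset Printing Implicit Defensive.

Import Order.TTheory GRing.Theory Num.Theory.
Import numFieldNormedType.Exports.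

Local Open Scope ring_scope.
Local Open Scope complex_scope.
Local Open Scope classical_set_scope.

(** Neighbourhoods of a matrix come from finite families of neighbourhoods of its entries, and a
    filter is stable under finite intersections. *)
Lemma cvg_mx (T : topologicalType) m n (F : set_system 'M[T]_(m, n))
    {FF : Filter F} (M : 'M[T]_(m, n)) :
  (forall i j, (fun N : 'M[T]_(m, n) => N i j) @ F --> M i j) -> F --> M.
Proof.
move=> FM A [P MP sPA]; apply: filterS sPA _.
by apply: filter_forall => i; apply: filter_forall => j; exact/FM/MP.
Qed.

Lemma norm_real_complex (R : rcfType) (x : R) : `|x%:C| = `|x|%:C.
Proof. by rewrite normc_def /= expr0n addr0 sqrtr_sqr. Qed.

Lemma cvg_real_complex (R : realType) (T : Type) (F : set_system T)
    {FF : Filter F} (f : T -> R) (a : R) :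
  f @ F --> a -> (fun x => (f x)%:C : R[i]^o) @ F --> (a%:C : R[i]^o).
Proof.
move=> /cvgrPdist_lt fa; apply/cvgrPdist_lt => e.
(* A positive [e] in [R[i]] has zero imaginary part, so its real part serves as the radius in
   [R]. *)
rewrite ltcE /= => /andP[e0 er]; near=> x.
rewrite -rmorphB norm_real_complex ltcE /= (eqP e0) eqxx /=.
by near: x; apply: fa.
Unshelve. all: by end_near. Qed.

(** Comparison test: the real and imaginary parts are bounded by the modulus, so both real series
    converge absolutely, and their limits are recombined. *)
Lemma is_cvg_seriesC (R : realType) (u : nat -> R[i]) (v : nat -> R) :
  (forall k, `|u k| <= (v k)%:C) -> cvgn (series v) ->
  cvgn (series (u : nat -> R[i]^o)).
Proof.
move=> uv cv.
have part (f : {additive R[i] -> R}) : (forall z, `|f z|%:C <= `|z|) ->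
    cvgn (series (f \o u)).
  move=> fle; have le k : `|f (u k)| <= v k.
    by rewrite -lecR (le_trans (fle _) (uv k)).
  apply: normed_cvg; apply: series_le_cvg cv => k //=.
  exact: le_trans (le k).
have Im_le (z : R[i]) : `|complex.Im z|%:C <= `|z|.
  (* Multiplying by ['i] turns the imaginary part into minus the real part and keeps the modulus. *)
  apply: le_trans (_ : `|z * 'i| <= _).
    by rewrite -(normrN (complex.Im z)) -ReiNIm normc_ge_Re.
  by rewrite normrM [`|'i|]normc_def /= expr0n expr1n add0r sqrtr1 mulr1.
have cR := part (@complex.Re R) (@normc_ge_Re R).
have cI := part (@complex.Im R) Im_le.
set sR := series _ in cR; set sI := series _ in cI.
apply/cvg_ex; exists ((limn sR)%:C + 'i * (limn sI)%:C : R[i]^o).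
rewrite (_ : series _ = fun m =>
    ((sR m)%:C : R[i]^o) + ('i : R[i]^o) * ((sI m)%:C : R[i]^o)).
  apply: cvgD; first exact: cvg_real_complex.
  by apply: cvgM; [exact: cvg_cst | exact: cvg_real_complex].
apply/funext => m; rewrite /sR /sI /series /=.
rewrite !rmorph_sum /= mulr_sumr -big_split /=.
by apply: eq_bigr => k _; rewrite {1}[u k]complexE.
Qed.

Lemma norm_expmx_coord_le (K : numDomainType) n (M : 'M[K]_n) k i j :
  `|(M ^+ k) i j| <= (\sum_i \sum_j `|M i j|) ^+ k.
Proof.
elim: k i j => [|k IH] i j.
  by rewrite !expr0 mxE; case: eqP; rewrite ?normr1 ?normr0.
rewrite exprS -[M * _]/(M *m _) mxE exprS.
apply: (le_trans (ler_norm_sum _ _ _)).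
(* Only row [i] of the left factor enters the product; the other rows of the bound are nonnegative
   and are dropped. *)
rewrite mulr_suml [leRHS](bigD1 i) //= -[leLHS]addr0; apply: lerD; last first.
  apply: sumr_ge0 => i' _; rewrite mulr_ge0 ?exprn_ge0 ?sumr_ge0 //.
  by move=> ? _; rewrite sumr_ge0.
rewrite mulr_suml; apply: ler_sum => l _.
by rewrite normrM ler_wpM2l.
Qed.

(** Needed for the [lim] in [expm] to be a genuine limit. Each entry is dominated by the real
    exponential series at the sum of the moduli of the entries of [M]. *)
Lemma is_cvg_expm (R : realType) n (M : 'M[R[i]]_n) :
  cvgn (series (fun k => (k`!%:R)^-1 *: M ^+ k : 'M[R[i]^o]_n)).
Proof.
set S := series _.
have cu i j : cvgn (fun m => S m i j : R[i]^o).
  rewrite (_ : (fun m => _) =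
      series (fun k => ((k`!%:R)^-1 *: M ^+ k) i j : R[i]^o)); last first.
    by apply/funext => m; rewrite /S /series /= summxE.
  pose B : R := \sum_i \sum_j complex.Re `|M i j|.
  have BE : \sum_i \sum_j `|M i j| = B%:C.
    rewrite rmorph_sum; apply: eq_bigr => a _; rewrite rmorph_sum.
    by apply: eq_bigr => b _; rewrite normc_def.
  apply: (is_cvg_seriesC _ (is_cvg_series_exp_coeff B)) => k.
  rewrite mxE normrM /exp_coeff /= mulrC rmorphM rmorphXn /= -BE.
  rewrite ler_pM ?norm_expmx_coord_le //.
  by rewrite normfV normr_nat fmorphV rmorph_nat.
apply/cvg_ex; exists (\matrix_(i, j) limn (fun m => S m i j : R[i]^o)).
by apply: cvg_mx => i j; rewrite mxE; exact: cu.
Qed.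

(** On [x] the partial sums of the matrix series act as those of the series of [expR r]. Since
    [N *m x] is continuous in [N], uniqueness of limits concludes. *)
Lemma expm_eigen (R : realType) n (M : 'M[R[i]]_n) (x : 'cV[R[i]]_n) (r : R) :
  M *m x = r%:C *: x -> expm M *m x = (expR r)%:C *: x.
Proof.
move=> Mx; apply/colP => i.
have Mkx k : M ^+ k *m x = (r ^+ k)%:C *: x.
  elim: k => [|k IH]; first by rewrite !expr0 mul1mx scale1r.
  rewrite exprSr -mulmxA Mx -scalemxAr IH scalerA.
  by rewrite exprS rmorphM.
have cE : (fun N : 'M[R[i]^o]_n => (N *m x) i 0 : R[i]^o) @
    (expm M : 'M[R[i]^o]_n) --> ((expm M *m x) i 0 : R[i]^o).
  rewrite mxE.
  rewrite (_ : (fun N : 'M[R[i]^o]_n => (N *m x) i 0 : R[i]^o) =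
      fun N : 'M[R[i]^o]_n => \sum_j N i j * (x j 0 : R[i]^o)); last first.
    by apply/funext => N; rewrite mxE.
  apply: (@cvg_big _ _ +%R 0 xpredT _ _ (nbhs (expm M : 'M[R[i]^o]_n))) =>
      [|j _]; first exact: add_continuous.
  by apply: cvgM; [exact: coord_continuous | exact: cvg_cst].
have cS := cvg_comp _ _ (@is_cvg_expm R n M) cE.
apply: (cvg_unique (@norm_hausdorff _ R[i]^o) cS).
rewrite mxE /=.
rewrite [X in X @ _ --> _](_ : _ = fun m =>
    ((series (exp_coeff r) m)%:C : R[i]^o) * (x i 0 : R[i]^o)).
  apply: cvgM; last exact: cvg_cst.
  by apply: cvg_real_complex; exact: is_cvg_series_exp_coeff.
apply/funext => m /=; rewrite /series /= mulmx_suml summxE rmorph_sum mulr_suml.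
apply: eq_bigr => k _; rewrite -scalemxAl Mkx !mxE mulrA /exp_coeff /=.
by rewrite rmorphM fmorphV rmorph_nat [_^-1 * _]mulrC.
Qed.

Lemma cexp_im (R : realType) (t : R) : cexp ('i * t%:C) = cos t +i* sin t.
Proof. by rewrite /cexp /= !mul0r mulr0 mul1r subr0 add0r expR0 mul1r. Qed.

Lemma cexp0 (R : realType) : cexp 0 = 1 :> R[i].
Proof. by rewrite /cexp /= expR0 cos0 sin0 mul1r. Qed.

Lemma cexp_im_norm (R : realType) (t : R) : `|cexp ('i * t%:C)| = 1.
Proof. by rewrite cexp_im normc_def /= cos2Dsin2 sqrtr1. Qed.

Section repr1.
Variables (R : realType) (gT : finGroupType) (chi : gT -> R[i]).
Hypothesis chi_repr : repr1 chi.

Lemma repr1_1 : chi 1%g = 1.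
Proof. by have [/matrixP/(_ 0 0)] := chi_repr; rewrite !mxE. Qed.

Lemma repr1_M g h : chi (g * h)%g = chi g * chi h.
Proof.
have [_ /(_ g h)] := chi_repr; rewrite !inE => /(_ isT isT).
by rewrite -scalar_mxM => /matrixP/(_ 0 0); rewrite !mxE.
Qed.

(** Since [g] has finite order, [chi g] is a root of unity. *)
Lemma repr1_norm g : `|chi g| = 1.
Proof.
have chiX k : chi (g ^+ k)%g = chi g ^+ k.
  by elim: k => [|k IH]; rewrite ?repr1_1 // expgS repr1_M IH exprS.
apply/eqP; rewrite -(@pexpr_eq1 _ _ #[g]%g) ?order_gt0 //.
by rewrite -normrX -chiX expg_order repr1_1 normr1.
Qed.

Lemma circulant_mul_group_vec (c : gT -> R[i]) :
  circulant c *m group_vec chi = (\sum_g c g * chi g) *: group_vec chi.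
Proof.
apply/colP => i; rewrite !mxE mulr_suml.
(* With tau the row and sigma the column, substitute g = tau^-1 sigma, so that chi(sigma) = chi(tau)
   chi(g). *)
pose h (j : 'I_#|gT|) : gT := ((enum_val i)^-1 * enum_val j)%g.
rewrite [RHS](reindex h) /=; last first.
  apply: onW_bij; exists (fun g => enum_rank (enum_val i * g)%g) => g.
    by rewrite /h mulKVg enum_valK.
  by rewrite /h enum_rankK mulKg.
apply: eq_bigr => j _.
by rewrite !mxE -mulrA [chi _ * _]mulrC /h -repr1_M mulKVg.
Qed.

End repr1.

Lemma phase_lag_rhs_Im (R : realType) n (A : 'M[R]_n) (eps phi : R)
    (theta : 'cV[R]_n) i :
  phase_lag_rhs A eps phi theta i 0 =
  complex.Im (cexp (- ('i * (theta i 0)%:C)) *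
    (phase_lag_mx A eps phi *m \col_j cexp ('i * (theta j 0)%:C)) i 0).
Proof.
have sinE (t : R) : sin t = complex.Im (cexp ('i * t%:C)) by rewrite cexp_im.
have ImZ (a : R) (z : R[i]) : complex.Im (a%:C * z) = a * complex.Im z.
  by case: z => x y /=; rewrite mul0r addr0.
rewrite !mxE !mulr_sumr raddf_sum; apply: eq_bigr => j _.
rewrite !mxE sinE -!ImZ; congr complex.Im.
rewrite (_ : 'i * _ =
    - ('i * (theta i 0)%:C) - 'i * phi%:C + 'i * (theta j 0)%:C).
  by rewrite !cexpD; ring.
by rewrite !rmorphB /=; ring.
Qed.

Lemma real_eigen_equilibrium (R : realType) n (A : 'M[R]_n) (eps phi r : R)
    (theta : 'cV[R]_n) :
  let x := \col_j cexp ('i * (theta j 0)%:C) in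
  phase_lag_mx A eps phi *m x = r%:C *: x ->
  phase_lag_equilibrium A eps phi theta /\
  complex_phase_lag_equilibrium A eps phi theta.
Proof.
move=> x Ax; split=> [i | x0 t _ i xt].
  (* The phases of [x] at [i] cancel, leaving the real number [r]. *)
  by rewrite phase_lag_rhs_Im Ax !mxE mulrCA -cexpD addNr cexp0 mulr1.
have xtE : xt = (expR (t * r))%:C * cexp ('i * (theta i 0)%:C).
  rewrite /xt (expm_eigen (r := t * r)) ?mxE //.
  by rewrite -scalemxAl Ax scalerA rmorphM.
have xt_norm : `|xt| = (expR (t * r))%:C.
  rewrite xtE normrM cexp_im_norm mulr1 norm_real_complex.
  by rewrite ger0_norm ?expR_ge0.
split; last by rewrite /is_arg xt_norm.
by rewrite -normr_gt0 xt_norm ltcR expR_gt0.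
Qed.

Local Close Scope classical_set_scope.

Theorem proposition10 (R : realType) (gT : finGroupType) (c : gT -> R)
    (eps : R) (chi : gT -> R[i]) (chi_repr : repr1 chi)
    (theta : 'cV[R]_#|gT|)
    (theta_arg : forall i, is_arg (group_vec chi i 0) (theta i 0))
    (phi : R) (phi_arg : is_arg (\sum_(g : gT) (c g)%:C * chi g) phi) :
  phase_lag_equilibrium (circulant c) eps phi theta /\
  complex_phase_lag_equilibrium (circulant c) eps phi theta.
Proof.
set Y := \sum_g _ in phi_arg.
(* The modulus is typed in [R[i]], whereas the eigenvalue must be supplied in [R]. *)
have YE : `|Y| = (complex.Re `|Y|)%:C by rewrite normc_def.
apply: (real_eigen_equilibrium (r := eps * complex.Re `|Y|)).
have -> : \col_j cexp ('i * (theta j 0)%:C) = group_vec chi.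
  apply/colP => i; have := theta_arg i; rewrite /is_arg !mxE.
  by rewrite repr1_norm // mul1r.
have circC : map_mx (real_complex R) (circulant c) =
    circulant (fun g => (c g)%:C) by apply/matrixP => i j; rewrite !mxE.
rewrite /phase_lag_mx circC -scalemxAl circulant_mul_group_vec // scalerA -/Y.
(* Writing Y in polar form cancels the phase lag; this covers Y = 0 with any [phi]. *)
congr (_ *: _); rewrite rmorphM /= -YE [in LHS]phi_arg -mulrA; congr (_ * _).
by rewrite mulrCA -cexpD addNr cexp0 mulr1.
Qed.
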